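(* Let $k\geq d\geq 2$ be integers, let $q$ be a power of an odd prime, and let \[ s=d-\frac{d-1}{k+1}. \] For every $c>0$ there is a constant $C>0$ (depending only on $c$ and $d$, not on $q$, $k$ or $E$) such that every $E\subset\mathbb{F}_q^d$ with $|E|\geq c\,q^s$ satisfies \[ |\Delta_k(E)|\geq C\,2^{-k^2}|\Delta_k(\mathbb{F}_q^d)|. \]
   Context: $\mathbb{F}_q^d$ is equipped with the dot product $x\cdot y=\sum_{i=1}^d x_iy_i$, and $O(\mathbb{F}_q^d)$ denotes the group of linear maps $\theta$ of $\mathbb{F}_q^d$ with $\theta x\cdot\theta y=x\cdot y$ for all $x,y$. A $(k+1)$-point configuration is a tuple $x=(x^1,\dots,x^{k+1})\in(\mathbb{F}_q^d)^{k+1}$. Two configurations $x,y$ are congruent, $x\sim y$, if there exist $\theta\in O(\mathbb{F}_q^d)$ and $z\in\mathbb{F}_q^d$ with $y^i=\theta x^i+z$ for every $i$. For $E\subset\mathbb{F}_q^d$, $\Delta_k(E)$ is the set of congruence classes of $(k+1)$-point configurations all of whose entries lie in $E$. *)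

(* Defs.v *)
From HB Require Import structures.
From mathcomp Require Import all_boot all_order all_algebra all_field.
From mathcomp Require Import reals exp.
Set Implicit Arguments. Unset Strict Implicit. Unset Printing Implicit Defensive.
Import Order.TTheory GRing.Theory Num.Theory.
Local Open Scope ring_scope.

Definition dotp (F : fieldType) (d : nat) (x y : 'rV[F]_d) : F :=
  \sum_(i < d) x 0 i * y 0 i.

Definition orthb (F : finFieldType) (d : nat) (M : 'M[F]_d) : bool :=
  [forall x : 'rV[F]_d, forall y : 'rV[F]_d,
     dotp (x *m M) (y *m M) == dotp x y].

Definition config (F : finFieldType) (d k : nat) := {ffun 'I_k.+1 -> 'rV[F]_d}.

Definition congruent (F : finFieldType) (d k : nat) (x y : config F d k) : bool :=
  [exists M : 'M[F]_d, orthb M &&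
     [exists z : 'rV[F]_d, [forall i, y i == x i *m M + z]]].

Definition cclass (F : finFieldType) (d k : nat) (x : config F d k)
  : {set config F d k} := [set y | congruent x y].

Definition Delta (F : finFieldType) (d k : nat) (E : {set 'rV[F]_d})
  : {set {set config F d k}} :=
  [set cclass x | x in [set x : config F d k | [forall i, x i \in E]]].

(* Main.v *)
Require Import Defs.
From HB Require Import structures.
From mathcomp Require Import all_boot all_order all_algebra all_field.
From mathcomp Require Import all_fingroup all_character.
From mathcomp Require Import reals exp.
From mathcomp Require Import ring lra zify.
Import Order.TTheory GRing.Theory Num.Theory.
Set Implicit Arguments. Unset Strict Implicit. Unset Printing Implicit Defensive.
Local Open Scope ring_scope.

(* Let [O] be the orthogonal group and, for [M] in [O] and a vector [z], let
   [l M z] be the number of [u] in [E] with [u M + z] in [E]. By Cauchy-Schwarz,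
   [|E|^(2(k+1)) <= |Delta_k E| * sum_(M, z) (l M z)^(k+1)]. The variance of [l]
   about its mean [a = |E|^2 / q^d] is computed with the Fourier transform: the
   nonzero frequencies contribute at most [q^d |E|^2] times the largest number
   of [M] in [O] sending a given nonzero [m] to a given [m'], which is
   [O(|O| / q^(d-1))] because the images of [m] under reflections already number
   at least a constant times [q^(d-1)]. With [l <= |E|] this yields
   [|Delta_k E| >= K^-1 q^(dk) / |O|] as soon as [|E|^(k+1) >= c^(k+1) q^(dk+1)].
   By Burnside's count, [|Delta_k F^d| * |O|] is at most the sum over [O] of
   [|ker (M - 1)|^k], and it is [O(q^(dk))] since [O(q^(dr))] elements of [O] have
   [rank (M - 1) = r]. Every estimate is relative to [|O|], whose order is never
   needed. *)

Lemma leq_card_fibers (T U : finType) (f : T -> U) (A : {set T}) (B : {set U})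
    (n : nat) :
  {in A, forall x, f x \in B} ->
  {in B, forall y, #|[set x in A | f x == y]| <= n}%N ->
  (#|A| <= #|B| * n)%N.
Proof.
move=> fAB fib; rewrite -sum1_card (partition_big f (mem B)) //=.
rewrite -sum_nat_const; apply: leq_sum => y By.
by rewrite sum1dep_card; apply: fib.
Qed.

(** * Orthogonal matrices and reflections *)

Section Orthogonal.
Variables (F : finFieldType) (d : nat).
Implicit Types (x y u v m : 'rV[F]_d) (M N : 'M[F]_d).
Local Notation q := #|F|.

Definition orth : {set 'M[F]_d} := [set M | orthb M].

Lemma card_rV : #|{: 'rV[F]_d}| = (q ^ d)%N.
Proof. by rewrite card_mx mul1n. Qed.

Lemma dotpE x y : dotp x y = (x *m y^T) 0 0.
Proof. by rewrite mxE; apply: eq_bigr => i _; rewrite mxE. Qed.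

Lemma dotpC x y : dotp x y = dotp y x.
Proof. by apply: eq_bigr => i _; rewrite mulrC. Qed.

Lemma dotpDl x y u : dotp (x + y) u = dotp x u + dotp y u.
Proof. by rewrite !dotpE mulmxDl mxE. Qed.

Lemma dotpDr x y u : dotp u (x + y) = dotp u x + dotp u y.
Proof. by rewrite !(dotpC u) dotpDl. Qed.

Lemma dotpZl a x y : dotp (a *: x) y = a * dotp x y.
Proof. by rewrite !dotpE -scalemxAl mxE. Qed.

Lemma dotpZr a x y : dotp x (a *: y) = a * dotp x y.
Proof. by rewrite dotpC dotpZl dotpC. Qed.

Lemma dotp0l x : dotp 0 x = 0.
Proof. by rewrite dotpE mul0mx mxE. Qed.

Lemma dotp_deltar x j : dotp x (delta_mx 0 j) = x 0 j.
Proof. by rewrite dotpE trmx_delta -colE mxE. Qed.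

Lemma dotp_mulmxr x y M : dotp x (y *m M) = dotp (x *m M^T) y.
Proof. by rewrite !dotpE trmx_mul mulmxA. Qed.

Lemma dotp_mx x y : x *m y^T = (dotp x y)%:M.
Proof. by rewrite [LHS]mx11_scalar dotpE. Qed.

Lemma mem_orth M : (M \in orth) = (M *m M^T == 1%:M).
Proof.
rewrite inE; apply/idP/eqP => [/forallP oM | MMt].
  apply/matrixP => i j.
  have := oM (delta_mx 0 i) => /forallP/(_ (delta_mx 0 j))/eqP.
  rewrite dotp_mulmxr -mulmxA !dotp_deltar -rowE mxE => ->.
  by rewrite !mxE eqxx eq_sym.
apply/forallP => x; apply/forallP => y.
by rewrite dotp_mulmxr -mulmxA MMt mulmx1.
Qed.

Lemma orth_mulVmx M : M \in orth -> M^T *m M = 1%:M.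
Proof. by rewrite mem_orth => /eqP/mulmx1C. Qed.

Lemma orth_mulmxV M : M \in orth -> M *m M^T = 1%:M.
Proof. by rewrite mem_orth => /eqP. Qed.

Lemma orth_tr M : M \in orth -> M^T \in orth.
Proof. by move=> oM; rewrite mem_orth trmxK orth_mulVmx. Qed.

Lemma orth_mul M N : M \in orth -> N \in orth -> M *m N \in orth.
Proof.
move=> oM oN; rewrite mem_orth trmx_mul mulmxA -(mulmxA M) orth_mulmxV //.
by rewrite mulmx1 orth_mulmxV.
Qed.

Lemma orth1 : 1%:M \in orth.
Proof. by rewrite mem_orth trmx1 mulmx1. Qed.

Lemma orth_row_inj M : M \in orth -> injective (fun x : 'rV_d => x *m M).
Proof.
move=> oM x y /(congr1 (fun x => x *m M^T)).
by rewrite -!mulmxA orth_mulmxV // !mulmx1.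
Qed.

(** Matrices act on rows from the right, so [v^T *m v] sends [x] to [dotp x v *: v]. For isotropic
    [v] the inverse of 0 is 0, which gives the identity. *)
Definition reflection v : 'M[F]_d := 1%:M - (2 / dotp v v) *: (v^T *m v).

Lemma mul_reflection x v :
  x *m reflection v = x - (2 * dotp x v / dotp v v) *: v.
Proof.
rewrite mulmxBr mulmx1 -scalemxAr mulmxA dotp_mx mul_scalar_mx scalerA.
by rewrite mulrAC.
Qed.

Lemma reflection_orth v : dotp v v != 0 -> reflection v \in orth.
Proof.
move=> v0; rewrite mem_orth.
have -> : (reflection v)^T = reflection v.
  by rewrite /reflection linearB /= trmx1 linearZ /= trmx_mul trmxK.
have vR : v *m reflection v = - v.
  rewrite mul_reflection mulfK // -[v in v - _]scale1r -scalerBl.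
  by rewrite (_ : 1 - 2 = -1) ?scaleN1r //; ring.
by rewrite {1}/reflection mulmxBl mul1mx -scalemxAl -mulmxA vR mulmxN scalerN
           opprK subrK.
Qed.

(** Double count of the pairs [(v, t)] with [v + t *: u] in [A]: each [t] occurs with [#|A|]
    vectors, each [v] with at most [n] scalars. *)
Lemma leq_card_lines (A : {set 'rV[F]_d}) u (n : nat) :
  (forall v : 'rV[F]_d, #|[set t | (v + t *: u)%R \in A]| <= n)%N ->
  (q * #|A| <= n * q ^ d)%N.
Proof.
move=> le_n.
have <- : (\sum_(v : 'rV[F]_d) \sum_(t : F | (v + t *: u)%R \in A) 1 = q * #|A|)%N.
  rewrite (exchange_big_dep predT) //= -sum_nat_const; apply: eq_bigr => t _.
  rewrite -[in RHS]sum1_card [RHS](reindex_inj (addIr (t *: u))) /=.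
  by apply: eq_bigl => v; rewrite ?inE.
rewrite mulnC -card_rV -sum_nat_const; apply: leq_sum => v _.
by rewrite sum1dep_card.
Qed.

(* For [m 0 j != 0], the restriction of the quadric times the hyperplane to any
   line of direction [e_j] has degree exactly 3. *)
Lemma card_reflection_degenerate m :
  m != 0 -> (q * #|[set v | (dotp v v * dotp m v == 0)%R]| <= 3 * q ^ d)%N.
Proof.
case/rV0Pn => j mj0.
apply: (@leq_card_lines _ (delta_mx 0 j)) => v.
pose p : {poly F} := ('X^2 + ((2 * v 0 j) *: 'X + (dotp v v)%:P))
  * ((m 0 j) *: 'X + (dotp m v)%:P).
have s1 : size ('X^2 + ((2 * v 0 j) *: 'X + (dotp v v)%:P)) = 3.
  rewrite size_polyDl ?size_polyXn // (leq_ltn_trans (size_polyD _ _)) //.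
  rewrite gtn_max (leq_ltn_trans (size_scale_leq _ _)) ?size_polyX //=.
  by rewrite (leq_ltn_trans (size_polyC_leq1 _)).
have s2 : size ((m 0 j) *: 'X + (dotp m v)%:P) = 2.
  by rewrite size_polyDl size_scale // size_polyX // ltnS size_polyC_leq1.
have p0 : p != 0 by rewrite mulf_neq0 // -size_poly_gt0 (s1, s2).
rewrite -ltnS cardE; have <- : size p = 4%N.
  by rewrite size_mul ?s1 ?s2 // -size_poly_gt0 (s1, s2).
apply: max_poly_roots => //; last exact: enum_uniq.
apply/allP => t; rewrite mem_enum !inE => /eqP tz.
apply/rootP; rewrite -{}[RHS]tz hornerM !hornerD hornerXn !hornerZ hornerX !hornerC.
rewrite !dotpDl !dotpDr !dotpZl !dotpZr.
rewrite (dotpC (delta_mx 0 j)) !dotp_deltar mxE !eqxx.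
by rewrite /= mulr1; ring.
Qed.

(** If [v] is anisotropic and not orthogonal to [m], then [m - m *m reflection v] is a nonzero
    multiple of [v], so each image comes from at most [q] such [v]. For [q > 3] at least a quarter
    of all vectors qualify. *)
Lemma leq_card_orbit m : (2 != 0 :> F) -> m != 0 ->
  (q ^ d <= 4 * 3 ^ d * q * #|[set m *m M | M in orth]%R|)%N.
Proof.
move=> F2 m0; set orb := [set _ | _ in _].
have orb_gt0 : (0 < #|orb|)%N.
  by apply/card_gt0P; exists (m *m 1%:M); rewrite imset_f ?orth1.
have q_gt0 : (0 < q)%N by apply/card_gt0P; exists 0.
(* For [q <= 3] the bound on degenerate vectors is vacuous; the factor [3 ^ d] covers this case. *)
have [q_le3|q_gt3] := leqP q 3.
  have le3 : (q ^ d <= 3 ^ d)%N by case: (posnP d) => [->|d0] //; rewrite leq_exp2r.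
  rewrite (leq_trans le3) // -mulnA mulnAC leq_pmull //.
  by rewrite !muln_gt0 q_gt0.
pose S := [set v | dotp v v * dotp m v != 0].
have le_S : (#|S| <= #|orb| * q)%N.
  apply: (@leq_card_fibers _ _ (fun v => m *m reflection v)) => [v|y _].
    by rewrite inE mulf_eq0 negb_or => /andP[v0 _]; rewrite imset_f ?reflection_orth.
  have /leq_trans-> // : (#|[set v in S | m *m reflection v == y]%R|
      <= #|[set s *: (m - y) | s : F]%R|)%N; last first.
    by rewrite (leq_trans (leq_imset_card _ _)) // cardT.
  apply: subset_leq_card; apply/subsetP => v; rewrite !inE mul_reflection.
  rewrite mulf_eq0 negb_or => /andP[/andP[v0 mv0] /eqP <-].
  have a0 : 2 * dotp m v / dotp v v != 0 by rewrite !mulf_neq0 ?invr_eq0.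
  apply/imsetP; exists (2 * dotp m v / dotp v v)^-1 => //.
  by rewrite opprB addrC subrK scalerA mulVf // scale1r.
have deg := card_reflection_degenerate m0.
have tot := cardsC [set v | dotp v v * dotp m v == 0].
have SE : ~: [set v | dotp v v * dotp m v == 0] = S by apply/setP => v; rewrite !inE.
have t_gt0 : (0 < 3 ^ d)%N by rewrite expn_gt0.
rewrite card_rV SE in tot.
have le4 : (q ^ d <= 4 * #|S|)%N.
  move: q_gt3 tot deg; clear.
  by move: #|S| (q ^ d)%N #|_| => a Q b; move: q => r; nia.
apply: (leq_trans le4); rewrite -!mulnA leq_mul2l (leq_trans le_S) //.
by rewrite [(#|orb| * q)%N]mulnC leq_pmull.
Qed.

(** Orbit-stabilizer inequality: for each [N] in [orth], right multiplication by [M0^T *m N] injects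
    the transporter into the matrices sending [m] to [m *m N]. *)
Lemma leq_card_transporter m m' : (2 != 0 :> F) -> m != 0 ->
  (q ^ d * #|[set M in orth | m *m M == m']%R| <= 4 * 3 ^ d * q * #|orth|)%N.
Proof.
move=> F2 m0; set T := [set M in _ | _].
have [->|[M0]] := set_0Vmem T; first by rewrite cards0 muln0.
rewrite inE => /andP[oM0 /eqP mM0].
suff le_orth : (#|[set m *m M | M in orth]%R| * #|T| <= #|orth|)%N.
  apply: leq_trans (leq_mul (leqnn _) le_orth).
  by rewrite mulnA leq_mul2r leq_card_orbit ?orbT.
rewrite -[leqRHS]sum1_card (partition_big_imset (fun M => m *m M)) /=.
rewrite -sum_nat_const; apply: leq_sum => _ /imsetP[N oN ->].
rewrite sum1dep_card.
rewrite -(card_imset (mem T) (f := fun M => M *m M0^T *m N)).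
  apply: subset_leq_card; apply/subsetP => _ /imsetP[M MT ->].
  have /setIdP[oM /eqP mM] : M \in T := MT.
  rewrite inE !orth_mul ?orth_tr //= !mulmxA mM -mM0.
  by rewrite -(mulmxA m) orth_mulmxV // mulmx1.
move=> M M' /(congr1 (fun X => X *m N^T *m M0)).
by rewrite -!mulmxA !(mulmxA N) !orth_mulmxV // !mul1mx !orth_mulVmx // !mulmx1.
Qed.

End Orthogonal.

(** * Second moment of the overlaps *)

(** The additive group is abelian, so it has [#|F| > 1] irreducible characters, all linear; any
    nontrivial one serves. *)
Lemma additive_character (F : finFieldType) : exists psi : F -> algC,
  [/\ {morph psi : x y / x + y >-> x * y}, forall x, `|psi x| = 1
    & exists x, psi x != 1].
Proof.
have abF : abelian [set: F]%G := FinRing.zmod_abelian _.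
have linF := char_abelianP _ abF.
have [i i0] : exists i : Iirr [set: F]%G, i != 0.
  apply/existsP; rewrite -negb_forall; apply/negP => /forallP i0.
  have := card_Iirr_abelian abF; rewrite cardsT => cF.
  have := finNzRing_gt1 F; rewrite -cF ltnNge => /negP; apply.
  by apply/card_le1_eqP => i j _ _; rewrite (eqP (i0 i)) (eqP (i0 j)).
exists 'chi_i; split=> [x y|x|].
- by have := lin_charM (linF i) (in_setT x) (in_setT y).
- by rewrite normC_lin_char ?linF ?in_setT.
apply/existsP; rewrite -negb_forall; apply: contra i0 => /forallP chi1.
rewrite -irr_eq1; apply/eqP/cfunP => x.
by rewrite cfun1E in_setT (eqP (chi1 x)).
Qed.

Section Fourier.
Variables (F : finFieldType) (d : nat) (psi : F -> algC).
Hypothesis psiD : {morph psi : x y / x + y >-> x * y}.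
Hypothesis psi_norm : forall x, `|psi x| = 1.
Hypothesis psi_nontrivial : exists x, psi x != 1.
Local Notation q := #|F|.
Implicit Types (x y u v m : 'rV[F]_d) (M : 'M[F]_d) (E : {set 'rV[F]_d}).

Lemma psi0 : psi 0 = 1.
Proof.
have psi_n0 : psi 0 != 0 by rewrite -normr_gt0 psi_norm.
by apply: (mulfI psi_n0); rewrite -psiD addr0 mulr1.
Qed.

Lemma psi_conj (x : F) : (psi x)^* = psi (- x).
Proof.
have psi_n0 : psi x != 0 by rewrite -normr_gt0 psi_norm.
by apply: (mulfI psi_n0); rewrite -normCK psi_norm expr1n -psiD subrr psi0.
Qed.

(** For [x != 0], translating [m] by a vector whose product with [x] is [t] multiplies the sum by
    [psi t != 1], so it vanishes. *)
Lemma sum_psi_dotp x : \sum_m psi (dotp x m) = (x == 0)%:R * (q ^ d)%:R.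
Proof.
have [->|x0] := eqVneq x 0.
  under eq_bigr do rewrite dotp0l psi0.
  by rewrite sumr_const mul1r -(card_rV F d).
rewrite mul0r; have /rV0Pn[j xj0] := x0.
have [t psit] := psi_nontrivial.
have shift : dotp x ((t / x 0 j) *: delta_mx 0 j) = t.
  by rewrite dotpZr dotp_deltar divfK.
have : (1 - psi t) * \sum_m psi (dotp x m) = 0.
  rewrite mulrBl mul1r {1}(reindex_inj (addrI ((t / x 0 j) *: delta_mx 0 j))) /=.
  apply/eqP; rewrite subr_eq0 mulr_sumr; apply/eqP; apply: eq_bigr => m _.
  by rewrite dotpDr shift psiD.
by move/eqP; rewrite mulf_eq0 subr_eq0 eq_sym (negPf psit) => /eqP.
Qed.

Definition fourier E m : algC := \sum_(u in E) psi (dotp u m).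

Lemma fourier_normE E m :
  `|fourier E m| ^+ 2 = \sum_(u in E) \sum_(v in E) psi (dotp (u - v) m).
Proof.
rewrite normCK rmorph_sum mulr_suml; apply: eq_bigr => u _.
rewrite mulr_sumr; apply: eq_bigr => v _.
by rewrite /= psi_conj -psiD dotpDl -scaleN1r dotpZl mulN1r.
Qed.

Lemma fourier0 E : fourier E 0 = #|E|%:R.
Proof.
rewrite /fourier; under eq_bigr do rewrite dotpC dotp0l psi0.
by rewrite sumr_const.
Qed.

Lemma plancherel E : \sum_m `|fourier E m| ^+ 2 = (q ^ d * #|E|)%:R.
Proof.
under eq_bigr do rewrite fourier_normE.
rewrite exchange_big /= mulnC natrM -sumr_const mulr_suml.
apply: eq_bigr => u uE; rewrite exchange_big /= mul1r.
rewrite (bigD1 u) //= subrr sum_psi_dotp eqxx mul1r big1 ?addr0 // => v /andP[vE uv].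
by rewrite sum_psi_dotp subr_eq0 eq_sym (negPf uv) mul0r.
Qed.

Definition overlap E M (z : 'rV[F]_d) : nat := #|[set u in E | u *m M + z \in E]|.

Lemma overlapE E M z : (overlap E M z)%:R =
  \sum_(u in E) \sum_(v in E) (z == v - u *m M)%:R :> algC.
Proof.
rewrite /overlap -sum1dep_card natr_sum big_mkcondr /=.
apply: eq_bigr => u uE; have [uzE|uzE] := boolP (_ \in E).
  rewrite (bigD1 (u *m M + z)) //= addrAC subrr add0r eqxx big1 ?addr0 // => v.
  move=> /andP[_ vz]; case: eqP => // zE; case/eqP: vz.
  by rewrite zE addrC subrK.
rewrite big1 // => v vE; case: eqP => // zE; case/negP: uzE.
by rewrite zE addrC subrK.
Qed.

Lemma sum_overlap E M : (\sum_z overlap E M z = #|E| ^ 2)%N.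
Proof.
apply/eqP; rewrite -(eqr_nat algC) natr_sum.
under eq_bigr do rewrite overlapE.
apply/eqP; rewrite exchange_big natrX expr2 -{1}sumr_const mulr_suml.
apply: eq_bigr => u uE; rewrite exchange_big mul1r -[RHS]sumr_const.
apply: eq_bigr => v vE; rewrite (bigD1 (v - u *m M)) //= eqxx big1 ?addr0 //.
by move=> z /negPf->.
Qed.

Lemma sum_overlap_sqr E M : M \in orth F d ->
  (q ^ d * \sum_z overlap E M z ^ 2)%:R
  = \sum_m `|fourier E m| ^+ 2 * `|fourier E (m *m M)| ^+ 2.
Proof.
move=> oM; rewrite natrM.
(* Eliminating [z] from [u *m M + z = v] and [u' *m M + z = v'] leaves one linear equation, which
   characters then detect. *)
have -> : (\sum_z overlap E M z ^ 2)%:R = \sum_(u in E) \sum_(u' in E)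
   \sum_(v in E) \sum_(v' in E) ((u - u') *m M + (v' - v) == 0)%:R :> algC.
  rewrite natr_sum; under eq_bigr do rewrite natrX overlapE expr2 mulr_suml.
  rewrite exchange_big; apply: eq_bigr => u uE /=.
  transitivity (\sum_z \sum_(u' in E) \sum_(v in E) \sum_(v' in E)
     (z == v - u *m M)%:R * (z == v' - u' *m M)%:R : algC).
    apply: eq_bigr => z _; rewrite mulr_sumr; apply: eq_bigr => u' _.
    rewrite mulr_suml; apply: eq_bigr => v _.
    by rewrite mulr_sumr.
  rewrite exchange_big; apply: eq_bigr => u' _ /=.
  rewrite exchange_big; apply: eq_bigr => v _ /=.
  rewrite exchange_big; apply: eq_bigr => v' _ /=.
  rewrite (bigD1 (v - u *m M)) //= eqxx mul1r.
  rewrite big1 ?addr0 => [|z /negPf->]; last first.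
    by rewrite mul0r.
  rewrite -subr_eq0 -oppr_eq0 mulmxBl.
  congr ((_ == _)%:R); rewrite !opprB addrACA [RHS]addrACA.
  by congr (_ + _); rewrite addrC.
transitivity (\sum_m \sum_(u in E) \sum_(u' in E) \sum_(v in E) \sum_(v' in E)
    psi (dotp ((u - u') *m M + (v' - v)) m)).
  rewrite mulr_sumr [RHS]exchange_big; apply: eq_bigr => u _ /=.
  rewrite mulr_sumr [RHS]exchange_big; apply: eq_bigr => u' _ /=.
  rewrite mulr_sumr [RHS]exchange_big; apply: eq_bigr => v _ /=.
  rewrite mulr_sumr [RHS]exchange_big; apply: eq_bigr => v' _ /=.
  by rewrite sum_psi_dotp mulrC.
(* Replacing [m] by [m *m M^T] moves [M] across the dot product, and the sum factors. *)
rewrite [RHS](reindex_inj (orth_row_inj (orth_tr oM))) /=.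
apply: eq_bigr => m _; rewrite -mulmxA orth_mulVmx // mulmx1 !fourier_normE.
rewrite mulr_suml; apply: eq_bigr => u _; rewrite mulr_suml; apply: eq_bigr => u' _.
rewrite exchange_big mulr_sumr; apply: eq_bigr => v _ /=.
rewrite mulr_sumr; apply: eq_bigr => v' _.
by rewrite dotp_mulmxr trmxK -psiD -dotpDl.
Qed.

(** Frequency 0 gives [#|E| ^ 4] for each [M]. For [m != 0], grouping by [m' = m *m M] and bounding
    the transporters leaves Plancherel sums over [m'], then over [m]. *)
Lemma sum_overlap_sqr_le E : 2 != 0 :> F ->
  (q ^ d * \sum_(M in orth F d) \sum_z overlap E M z ^ 2
   <= #|orth F d| * (#|E| ^ 4 + 4 * 3 ^ d * q ^ d.+1 * #|E| ^ 2))%N.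
Proof.
move=> F2; set K := (4 * 3 ^ d * q * #|orth F d|)%N.
have fE_ge0 m : 0 <= `|fourier E m| ^+ 2 by rewrite exprn_ge0.
have inner m : m != 0 ->
    (q ^ d)%:R * (\sum_(M in orth F d) `|fourier E (m *m M)| ^+ 2)
    <= (K * (q ^ d * #|E|))%:R.
  move=> m0; rewrite (partition_big (fun M => m *m M) xpredT) //=.
  rewrite natrM -plancherel !mulr_sumr; apply: ler_sum => m' _.
  under eq_bigr => M /andP[_ /eqP->] do [].
  rewrite sumr_const -[_ ^+ 2 *+ _]mulr_natr mulrCA mulrC.
  rewrite ler_wpM2r // -natrM ler_nat.
  have := leq_card_transporter m' F2 m0; rewrite -/K; apply: leq_trans.
  by rewrite leq_mul2l; apply/orP; right;
    apply: subset_leq_card; apply/subsetP => M; rewrite inE.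
suff: (q ^ d * (q ^ d * \sum_(M in orth F d) \sum_z overlap E M z ^ 2)
  <= q ^ d * (#|orth F d| * #|E| ^ 4) + K * (q ^ d * #|E|) ^ 2)%N.
  have qd : (0 < q ^ d)%N.
    by rewrite expn_gt0; apply/orP; left; apply/card_gt0P; exists 0.
  move=> le_qd; rewrite -(leq_pmul2l qd); apply: (leq_trans le_qd).
  by rewrite /K (expnS q d); apply: eq_leq; ring.
rewrite -(ler_nat algC) natrM big_distrr natr_sum.
under eq_bigr => M oM do rewrite sum_overlap_sqr //.
rewrite exchange_big /= mulr_sumr (bigD1 0) //= natrD; apply: lerD.
  under eq_bigr => M oM do rewrite mul0mx fourier0 normr_nat -!natrX -natrM.
  by rewrite sumr_const -[_%:R *+ _]mulr_natr -!natrM ler_nat; apply: eq_leq; ring.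
have -> : (K * (q ^ d * #|E|) ^ 2 = q ^ d * #|E| * (K * (q ^ d * #|E|)))%N by ring.
rewrite natrM -plancherel mulr_suml [leRHS](bigD1 0) //=.
apply: ler_wpDl; first by rewrite mulr_ge0.
apply: ler_sum => m m0; rewrite -mulr_sumr mulrCA.
by rewrite ler_wpM2l // inner.
Qed.

End Fourier.

(** * Fixed spaces *)

Section FixedSpaces.
Variables (F : finFieldType) (d : nat).
Local Notation q := #|F|.
Local Notation orth := (orth F d).
Implicit Types (M N : 'M[F]_d).

Definition fixed M : {set 'rV[F]_d} := [set x | x *m M == x].

Lemma card_fixed M : #|fixed M| = (q ^ (d - \rank (M - 1%:M)%R))%N.
Proof.
rewrite -mxrank_ker -card_rowg; apply: eq_card => x.
by rewrite !inE sub_kermx mulmxBr mulmx1 subr_eq0.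
Qed.

(** As [M^T] inverts [M], both equations say that [M] fixes the rows of [X]. The right one makes the
    fixed space the orthogonal complement of the row space of [M - 1]. *)
Lemma mulmx_orth_fixed n (X : 'M[F]_(n, d)) M :
  M \in orth -> (X *m (M - 1%:M) == 0) = ((M - 1%:M) *m X^T == 0).
Proof.
move=> oM; rewrite -[RHS](inj_eq trmx_inj) trmx_mul trmxK trmx0.
rewrite [(M - _)^T]linearB /= trmx1.
rewrite !mulmxBr !mulmx1 !subr_eq0; apply/eqP/eqP => {1}<-.
  by rewrite -mulmxA orth_mulmxV // mulmx1.
by rewrite -mulmxA orth_mulVmx // mulmx1.
Qed.

(* The kernel of [M - 1] is the orthogonal complement of its row space, so it
   can be read off the chosen rows; [M] and [M'] agree on it and on those rows. *)
Lemma orth_eq_rows r (f : 'I_r -> 'I_d) M M' :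
  M \in orth -> M' \in orth ->
  (M - 1%:M <= rowsub f (M - 1%:M))%MS ->
  (M' - 1%:M <= rowsub f (M' - 1%:M))%MS ->
  rowsub f M = rowsub f M' -> M = M'.
Proof.
move=> oM oM' /submxP[P NP] /submxP[P' NP'] eqf.
pose Z : 'M[F]_(r, d) := rowsub f 1%:M.
have ZE (X : 'M_d) : rowsub f X = Z *m X by rewrite mul_rowsub_mx mul1mx.
have ZN : Z *m (M - 1%:M) = Z *m (M' - 1%:M).
  by rewrite !mulmxBr -!ZE eqf.
rewrite ZE in NP; rewrite ZE in NP'.
have : (1%:M - P *m Z) *m (M - 1%:M) == 0.
  by rewrite mulmxBl mul1mx -mulmxA -NP subrr.
rewrite mulmx_orth_fixed // => /eqP NX.
(* The rows of [1%:M - P *m Z] are orthogonal to the chosen rows, common to [M - 1] and [M' - 1],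
   hence to all rows of [M' - 1]. *)
have : (1%:M - P *m Z) *m (M' - 1%:M) == 0.
  by rewrite mulmx_orth_fixed // NP' -ZN -!mulmxA NX !mulmx0.
rewrite mulmxBl mul1mx subr_eq0 -mulmxA -ZN -NP => /eqP.
by move/(congr1 (fun X => X + 1%:M)); rewrite !subrK.
Qed.

(** Some [r] rows of [M - 1] span its row space: [d ^ r] choices of indices, at most [q ^ (r * d)]
    values, and [orth_eq_rows] recovers [M]. *)
Lemma card_orth_rank r :
  (#|[set M in orth | \rank (M - 1%:M)%R == r]| <= d ^ r * q ^ (r * d))%N.
Proof.
pose B (f : {ffun 'I_r -> 'I_d}) :=
  [set M in orth | (M - 1%:M <= rowsub f (M - 1%:M))%MS].
have leB f : (#|B f| <= q ^ (r * d))%N.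
  rewrite -card_mx; apply: (@leq_card_in _ _ (fun M => rowsub f M)) => M M'.
  by move=> /setIdP[oM fM] /setIdP[oM' fM']; apply: orth_eq_rows.
have -> : (d ^ r = #|{ffun 'I_r -> 'I_d}|)%N by rewrite card_ffun !card_ord.
rewrite -sum_nat_const; apply: leq_trans (leq_sum _ (fun f _ => leB f)).
rewrite -sum1_card; under [leqRHS]eq_bigr do rewrite -sum1_card.
rewrite (exchange_big_dep (mem orth)) /=; last by move=> f M _ /setIdP[].
rewrite big_mkcond [leqRHS]big_mkcond; apply: leq_sum => M _.
case: ifP => [/setIdP[oM /eqP rM]|_] //; rewrite oM sum1dep_card.
have [f fM] : exists f : {ffun 'I_r -> 'I_d},
    (M - 1%:M <= rowsub f (M - 1%:M))%MS.
  rewrite -rM; exists (finfun (maxrankfun (M - 1%:M))).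
  rewrite (_ : rowsub _ _ = rowsub (maxrankfun (M - 1%:M)) (M - 1%:M)).
    by rewrite eq_maxrowsub.
  by apply/matrixP => i j; rewrite !mxE ffunE.
by apply/card_gt0P; exists f; rewrite inE; apply/setIdP.
Qed.

(** Rank [r] contributes at most [d ^ r * q ^ (r * d + (d - r) * k)], whose exponent of [q] is at
    most [d * k] because [d <= k]. *)
Lemma sum_fixed_exp k : (d <= k)%N ->
  (\sum_(M in orth) #|fixed M| ^ k <= d.+1 * d ^ d * q ^ (d * k))%N.
Proof.
move=> dk; have q_gt0 : (0 < q)%N by apply/card_gt0P; exists 0.
rewrite (partition_big (fun M => inord (\rank (M - 1%:M)) : 'I_d.+1) xpredT) //=.
rewrite -mulnA -[X in (_ <= X * _)%N](card_ord d.+1) -sum_nat_const.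
apply: leq_sum => r _.
have rE M : (inord (\rank (M - 1%:M)) == r :> 'I_d.+1) = (\rank (M - 1%:M) == r).
  by rewrite -val_eqE /= inordK // ltnS rank_leq_row.
under eq_bigl do rewrite rE.
under eq_bigr => M /andP[_ /eqP rM] do rewrite card_fixed rM -expnM.
rewrite sum_nat_cond_const.
apply: leq_trans (leq_mul (card_orth_rank r) (leqnn _)) _.
have rd : (r <= d)%N by rewrite -ltnS.
have dr (j : nat) : (j <= d)%N -> (d ^ j <= d ^ d)%N.
  by case: (posnP d) => [->|d0]; [rewrite leqn0 => /eqP-> | exact: leq_pexp2l].
rewrite -mulnA -expnD leq_mul ?dr //.
rewrite leq_pexp2l // -[leqRHS](congr1 (muln^~ k) (subnKC rd)) mulnDl.
by rewrite leq_add2r leq_mul2l dk orbT.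
Qed.

End FixedSpaces.

(** * Congruence classes *)

Section Congruence.
Variables (F : finFieldType) (d k : nat).
Local Notation q := #|F|.
Local Notation orth := (orth F d).
Implicit Types (x y : config F d k) (p : 'M[F]_d * 'rV[F]_d) (E : {set 'rV[F]_d}).

Definition motions : {set 'M[F]_d * 'rV[F]_d} := setX orth setT.

Definition displace x p : config F d k := [ffun i => x i *m p.1 + p.2].

Lemma card_motions : #|motions| = (#|orth| * q ^ d)%N.
Proof. by rewrite cardsX cardsT card_rV. Qed.

Lemma sum_motions (f : 'M[F]_d * 'rV[F]_d -> nat) :
  (\sum_(p in motions) f p = \sum_(M in orth) \sum_z f (M, z))%N.
Proof.
rewrite pair_big_dep /=; apply: eq_big => [[M z]|[M z]] //=.
by rewrite in_setX in_setT.
Qed.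

Lemma congruentP x y :
  reflect (exists2 p, p \in motions & y = displace x p) (congruent x y).
Proof.
apply: (iffP existsP) => [[M /andP[oM /existsP[z /forallP xy]]]|[[M z]]].
  exists (M, z); first by rewrite in_setX !inE oM.
  by apply/ffunP => i; rewrite ffunE (eqP (xy i)).
rewrite in_setX inE => /andP[oM _] ->; exists M; rewrite oM; apply/existsP.
by exists z; apply/forallP => i; rewrite ffunE.
Qed.

Lemma congruent_refl x : congruent x x.
Proof.
apply/congruentP; exists (1%:M, 0); first by rewrite in_setX orth1 in_setT.
by apply/ffunP => i; rewrite ffunE mulmx1 addr0.
Qed.

Lemma congruent_sym x y : congruent x y -> congruent y x.
Proof.
move=> /congruentP[[M z]]; rewrite in_setX => /andP[oM _] ->; apply/congruentP.
exists (M^T, - z *m M^T); first by rewrite in_setX orth_tr ?in_setT.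
apply/ffunP => i; rewrite !ffunE /= -mulmxDl addrK -mulmxA orth_mulmxV //.
by rewrite mulmx1.
Qed.

Lemma congruent_trans x y w : congruent x y -> congruent y w -> congruent x w.
Proof.
move=> /congruentP[[M z]]; rewrite in_setX => /andP[oM _] ->.
move=> /congruentP[[N t]]; rewrite in_setX => /andP[oN _] ->; apply/congruentP.
exists (M *m N, z *m N + t); first by rewrite in_setX orth_mul ?in_setT.
by apply/ffunP => i; rewrite !ffunE /= mulmxDl -mulmxA addrA.
Qed.

Lemma mem_cclass x y : (y \in cclass x) = congruent x y.
Proof. exact: in_set. Qed.

Lemma cclass_eq x y : (cclass x == cclass y) = congruent x y.
Proof.
apply/eqP/idP => [xy|xy]; first by rewrite -mem_cclass xy mem_cclass congruent_refl.
apply/setP => w; rewrite !mem_cclass; apply/idP/idP.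
  exact: (congruent_trans (congruent_sym xy)).
exact: (congruent_trans xy).
Qed.

Definition stab x := [set p in motions | displace x p == x].

(** Composing with the inverse of one motion from [x] to [y] injects all such motions into
    [stab x]. *)
Lemma leq_motions_class_stab x : (#|motions| <= #|cclass x| * #|stab x|)%N.
Proof.
apply: (@leq_card_fibers _ _ (displace x)) => [p pG|y _].
  by rewrite mem_cclass; apply/congruentP; exists p.
have [->|[[M0 z0]]] := set_0Vmem [set p in motions | displace x p == y].
  by rewrite cards0.
case/setIdP; rewrite in_setX => /andP[oM0 _] /eqP y0.
rewrite -(card_in_imset (f := fun p => (p.1 *m M0^T, (p.2 - z0) *m M0^T))).
  apply: subset_leq_card; apply/subsetP => _ /imsetP[[M z] pT ->].
  case/setIdP: pT; rewrite in_setX => /andP[/= oM _] /eqP yE; apply/setIdP; split.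
    by rewrite in_setX orth_mul ?orth_tr ?in_setT.
  apply/eqP/ffunP => i; rewrite ffunE /= mulmxA -mulmxDl.
  have /ffunP/(_ i) := etrans yE (esym y0); rewrite !ffunE /= => E.
  by rewrite addrA E addrK -mulmxA orth_mulmxV // mulmx1.
move=> [M z] [N t] _ _ /= [/(congr1 (mulmx^~ M0)) MN /(congr1 (mulmx^~ M0)) zt].
move: MN zt; rewrite /= -!mulmxA orth_mulVmx // !mulmx1 => -> /(congr1 (+%R^~ z0)).
by rewrite /= !subrK => ->.
Qed.

Lemma card_Delta_full :
  (#|Delta k [set: 'rV[F]_d]| * #|motions| <= \sum_(x : config F d k) #|stab x|)%N.
Proof.
rewrite (partition_big (@cclass F d k) (mem (Delta k [set: 'rV[F]_d]))) /=; last first.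
  move=> x _; apply: imset_f; rewrite inE; apply/forallP => i; exact: in_setT.
rewrite -sum_nat_const; apply: leq_sum => _ /imsetP[x _ ->].
have c_gt0 : (0 < #|cclass x|)%N.
  by apply/card_gt0P; exists x; rewrite mem_cclass congruent_refl.
(* With the class size as a factor, the orbit-stabilizer bound applies at each [y] of the class
   separately. *)
rewrite -(leq_pmul2l c_gt0) big_distrr /= -sum_nat_const.
rewrite [leqRHS](eq_bigl (mem (cclass x))); last first.
  by move=> y; rewrite /= cclass_eq mem_cclass; apply/idP/idP; apply: congruent_sym.
apply: leq_sum => y; rewrite mem_cclass -cclass_eq => /eqP->.
exact: leq_motions_class_stab.
Qed.

Lemma card_configs (A : {set 'rV[F]_d}) :
  #|[set x : config F d k | [forall i, x i \in A]]| = (#|A| ^ k.+1)%N.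
Proof.
rewrite -[in RHS](card_ord k.+1) -card_ffun_on; apply: eq_card => x.
by rewrite inE; apply/forallP/ffun_onP.
Qed.

(** The fixed points of [(M, z)] are empty or a translate of [fixed M], which bounds [k] of the
    [k.+1] factors. The last one sums over [z] to [q ^ d]: each [u] is fixed only for
    [z = u - u *m M]. *)
Lemma sum_stab :
  (\sum_(x : config F d k) #|stab x| <= q ^ d * \sum_(M in orth) #|fixed M| ^ k)%N.
Proof.
under [leqLHS]eq_bigr do rewrite -sum1_card.
rewrite (exchange_big_dep (mem motions)) /=; last by move=> x p _ /setIdP[].
rewrite sum_motions big_distrr; apply: leq_sum => M oM.
pose fixz z := [set u : 'rV[F]_d | u *m M + z == u].
have fixE z : (\sum_(x | (M, z) \in stab x) 1 = #|fixz z| ^ k.+1)%N.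
  rewrite -card_configs sum1dep_card; apply: eq_card => x; rewrite [LHS]inE [RHS]inE.
  apply/setIdP/forallP => [[_ /eqP/ffunP xE] i|xE].
    by have := xE i; rewrite ffunE inE => ->.
  split; first by rewrite in_setX oM in_setT.
  by apply/eqP/ffunP => i; have := xE i; rewrite ffunE inE => /eqP.
have <- : (\sum_z #|fixz z| = q ^ d)%N.
  under eq_bigr do rewrite -sum1_card.
  rewrite (exchange_big_dep xpredT) //= -card_rV -sum1_card; apply: eq_bigr => u _.
  rewrite (big_pred1 (u - u *m M)) // => z.
  by rewrite inE addrC -subr_eq0 -[RHS]subr_eq0 opprB addrA.
rewrite big_distrl; apply: leq_sum => z _; rewrite fixE expnS leq_mul2l.
apply/orP; right;
have leX a b : (a <= b -> a ^ k <= b ^ k)%N.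
  by case: (k) => // j ab; rewrite leq_exp2r.
apply: leX.
have [->|[u0]] := set_0Vmem (fixz z); first by rewrite cards0.
rewrite inE => /eqP u0E; rewrite -(card_imset (mem (fixz z)) (addIr (- u0))).
apply: subset_leq_card; apply/subsetP => _ /imsetP[u uz ->].
have : u \in fixz z := uz; rewrite !inE => /eqP uE.
by rewrite mulmxBl -{2}uE -{2}u0E opprD addrACA subrr addr0.
Qed.

Lemma leq_sqr_sum (T : finType) (B : {set T}) (f : T -> nat) :
  ((\sum_(y in B) f y) ^ 2 <= #|B| * \sum_(y in B) f y ^ 2)%N.
Proof.
rewrite -(leq_pmul2l (isT : 0 < 2)%N).
have -> : (2 * (\sum_(y in B) f y) ^ 2 =
    \sum_(y in B) \sum_(w in B) 2 * (f y * f w))%N.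
  rewrite expnS expn1 big_distrl big_distrr; apply: eq_bigr => y _ /=.
  by rewrite big_distrr big_distrr.
have -> : (2 * (#|B| * \sum_(y in B) f y ^ 2) =
    \sum_(y in B) \sum_(w in B) (f y ^ 2 + f w ^ 2))%N.
  under [RHS]eq_bigr do rewrite big_split sum_nat_const.
  by rewrite big_split sum_nat_const -big_distrr /= mul2n addnn.
by apply: leq_sum => y _; apply: leq_sum => w _; apply: (nat_Cauchy _ _).1.
Qed.

(** Cauchy-Schwarz over classes: the sum of [n D ^ 2] counts congruent pairs in [E], each realised
    by at least one motion, and [(M, z)] keeps [overlap E M z ^ k.+1] configurations inside [E]. *)
Lemma leq_card_Delta E :
  (#|E| ^ (2 * k.+1) <=
   #|Delta k E| * \sum_(M in orth) \sum_z overlap E M z ^ k.+1)%N.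
Proof.
pose A := [set x : config F d k | [forall i, x i \in E]].
pose n D := (\sum_(x in A | cclass x == D) 1)%N.
have nE : (\sum_(D in Delta k E) n D = #|E| ^ k.+1)%N.
  rewrite -card_configs -sum1_card; apply/esym/partition_big => x xA.
  exact: imset_f.
rewrite mulnC expnM -nE; apply: leq_trans (leq_sqr_sum _ _) _.
rewrite leq_mul2l; apply/orP; right.
have -> : (\sum_(D in Delta k E) n D ^ 2 = \sum_(x in A) n (cclass x))%N.
  rewrite [RHS](partition_big (@cclass F d k) (mem (Delta k E))) /=; last first.
    by move=> x xA; apply: imset_f.
  apply: eq_bigr => D _; rewrite expnS expn1 {1}/n big_distrl /=.
  by apply: eq_bigr => x /andP[_ /eqP->]; rewrite mul1n.
have leA x : x \in A ->
    (n (cclass x) <= \sum_(p in motions | displace x p \in A) 1)%N.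
  move=> xA; rewrite /n !sum1dep_card.
  apply: leq_trans (leq_imset_card (displace x) _).
  apply: subset_leq_card; apply/subsetP => y; move=> /setIdP[yA].
  rewrite eq_sym cclass_eq => /congruentP[p pG yE].
  by rewrite yE; apply: imset_f; rewrite inE pG -yE.
apply: (leq_trans (leq_sum _ leA)).
rewrite (exchange_big_dep (mem motions)) /=; last by move=> x p _ /andP[].
rewrite sum_motions; apply: leq_sum => M oM; apply: leq_sum => z _.
rewrite sum1dep_card /overlap -card_configs; apply: subset_leq_card.
apply/subsetP => x; rewrite !inE => /and3P[/forallP xE _ /forallP mE].
by apply/forallP => i; rewrite inE xE; have := mE i; rewrite ffunE.
Qed.

End Congruence.

(** * Higher moments *)

(** Either [l <= 2 * a], or [l < 2 * (l - a)]; then two factors are bounded by the deviation and the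
    other [k.-1] by [e]. *)
Lemma expr_le_deviation (R : realFieldType) (l a e : R) (k : nat) : (0 < k)%N ->
  0 <= a -> 0 <= l <= e ->
  l ^+ k.+1 <= (2 * a) ^+ k.+1 + 4 * e ^+ k.-1 * (l - a) ^+ 2.
Proof.
case: k => // k _ a0 /andP[l0 le] /=.
have e0 : 0 <= e by apply: le_trans le.
have dev : 0 <= 4 * e ^+ k * (l - a) ^+ 2.
  by apply: mulr_ge0; [apply: mulr_ge0; rewrite ?ler0n ?exprn_ge0 | exact: sqr_ge0].
have a2 : 0 <= 2 * a by rewrite mulr_ge0.
have [la|al] := leP l (2 * a).
  by rewrite -[leLHS]addr0 lerD // lerXn2r ?nnegrE.
apply: ler_wpDl; first by rewrite exprn_ge0.
rewrite -addn2 exprD (mulrC 4) -mulrA ler_pM ?exprn_ge0 ?lerXn2r ?nnegrE //.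
by nra.
Qed.

Lemma sum_overlap_exp (R : realFieldType) (F : finFieldType) (d k : nat)
    (E : {set 'rV[F]_d}) : 2 != 0 :> F -> (0 < k)%N ->
  (\sum_(M in orth F d) \sum_z overlap E M z ^ k.+1)%N%:R <=
  #|orth F d|%:R * (#|F|%:R ^+ d * (2 * (#|E|%:R ^+ 2 / #|F|%:R ^+ d)) ^+ k.+1
    + 4 * (4 * 3 ^+ d) * #|F|%:R * #|E|%:R ^+ k.+1) :> R.
Proof.
move=> F2 k0; set q : R := #|F|%:R; set e : R := #|E|%:R.
set N : R := #|_|%:R; set a := e ^+ 2 / q ^+ d.
have q_gt0 : 0 < q by rewrite ltr0n; apply/card_gt0P; exists 0.
have qd_gt0 : 0 < q ^+ d by rewrite exprn_gt0.
have e0 : 0 <= e by rewrite ler0n.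
have a0 : 0 <= a by rewrite divr_ge0 ?exprn_ge0 // ltW.
have N0 : 0 <= N by rewrite ler0n.
pose l M z : R := (overlap E M z)%:R.
have leM M z : 0 <= l M z <= e.
  rewrite ler0n ler_nat /=; apply: subset_leq_card; apply/subsetP => u.
  by case/setIdP.
have sum1 : \sum_(M in orth F d) \sum_z l M z = N * e ^+ 2.
  rewrite (eq_bigr (fun=> e ^+ 2)) ?sumr_const -?[_ ^+ 2 *+ _]mulr_natl // => M _.
  by rewrite -natr_sum sum_overlap natrX.
have sum2 : q ^+ d * \sum_(M in orth F d) \sum_z l M z ^+ 2
    <= N * (e ^+ 4 + 4 * 3 ^+ d * q ^+ d.+1 * e ^+ 2).
  have [psi [psiD psi1 psiN]] := additive_character F.
  have := sum_overlap_sqr_le psiD psi1 psiN E F2.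
  rewrite -(ler_nat R) !natrM natrX natrD !natrM !natrX natr_sum.
  congr (_ * _ <= _); apply: eq_bigr => M _; rewrite natr_sum.
  by apply: eq_bigr => z _; rewrite natrX.
have sum0 (b : R) : \sum_(M in orth F d) \sum_(z : 'rV[F]_d) b = N * (q ^+ d * b).
  rewrite !sumr_const -[_ *+ _ in LHS]mulr_natl.
  have -> : b *+ #|{: 'rV[F]_d}| = q ^+ d * b by rewrite card_rV -mulr_natl natrX.
  by [].
have var : \sum_(M in orth F d) \sum_z (l M z - a) ^+ 2
    <= N * (4 * 3 ^+ d * q * e ^+ 2).
  have -> : \sum_(M in orth F d) \sum_z (l M z - a) ^+ 2 =
    \sum_(M in orth F d) \sum_z l M z ^+ 2 - 2 * a * (N * e ^+ 2)
    + N * (q ^+ d * a ^+ 2).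
    rewrite -sum1 -(sum0 (a ^+ 2)) mulr_sumr -sumrB -big_split /=.
    apply: eq_bigr => M _; rewrite mulr_sumr -sumrB -big_split /=.
    by apply: eq_bigr => z _; ring.
  rewrite -(ler_pM2l qd_gt0); move: sum2; set S := (\sum_(M in _) \sum_z _) => sum2.
  have aE : q ^+ d * a = e ^+ 2 by rewrite mulrC divfK // gt_eqF.
  (* Centring at the mean [a] removes exactly the zero-frequency term [N * e ^+ 4]. *)
  have -> : q ^+ d * (S - 2 * a * (N * e ^+ 2) + N * (q ^+ d * a ^+ 2)) =
     q ^+ d * S - N * e ^+ 4.
    have -> : e ^+ 4 = e ^+ 2 * e ^+ 2 by ring.
    by rewrite -aE; ring.
  rewrite lerBlDl; apply: (le_trans sum2); rewrite (exprS q d).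
  by rewrite le_eqVlt; apply/orP; left; apply/eqP; ring.
rewrite natr_sum.
apply: (@le_trans _ _ (\sum_(M in orth F d) \sum_z
    ((2 * a) ^+ k.+1 + 4 * e ^+ k.-1 * (l M z - a) ^+ 2))).
  apply: ler_sum => M _; rewrite natr_sum; apply: ler_sum => z _.
  by rewrite natrX; apply: expr_le_deviation; rewrite ?leM.
have -> : \sum_(M in orth F d) \sum_z
    ((2 * a) ^+ k.+1 + 4 * e ^+ k.-1 * (l M z - a) ^+ 2) =
   N * (q ^+ d * (2 * a) ^+ k.+1) +
   4 * e ^+ k.-1 * \sum_(M in orth F d) \sum_z (l M z - a) ^+ 2.
  rewrite -sum0 mulr_sumr -big_split /=; apply: eq_bigr => M _.
  by rewrite mulr_sumr -big_split.
rewrite mulrDr lerD2l.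
apply: le_trans (ler_wpM2l _ var) _; first by rewrite mulr_ge0 ?exprn_ge0.
have -> : e ^+ k.+1 = e ^+ k.-1 * e ^+ 2 by rewrite -exprD addn2 prednK.
by rewrite le_eqVlt; apply/orP; left; apply/eqP; ring.
Qed.

(** With [b <= 2 ^+ n] it suffices that [n * k.+1 <= n * n + n + k * k]. Factors exponential in [k]
    are thus absorbed with a constant independent of [k]. *)
Lemma exp_le_exp2_sqr (R : archiRealFieldType) (b : R) : 0 <= b ->
  exists2 A : R, 0 < A & forall k, b ^+ k.+1 <= A * 2 ^+ (k * k).
Proof.
move=> b0; pose n := Num.bound b.
exists (2 ^+ (n * n + n)) => [|k]; first by rewrite exprn_gt0.
have bn : b <= 2 ^+ n.
  have := archi_boundP b0; rewrite -/n => /ltW/le_trans; apply.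
  by rewrite -natrX ler_nat ltnW // ltn_expl.
apply: (@le_trans _ _ ((2 ^+ n) ^+ k.+1)); first by rewrite lerXn2r ?nnegrE ?exprn_ge0.
rewrite -exprM -exprD; apply: ler_weXn2l; first by rewrite ler1n.
by nia.
Qed.

(** * Comparison of the class counts for [E] and for the whole space *)

Theorem theorem2 (R : realType) (d : nat) (hd : (2 <= d)%N) (c : R) (hc : 0 < c) :
  exists C : R, 0 < C /\
    forall (F : finFieldType), 2 \notin [pchar F] ->
    forall (k : nat), (d <= k)%N ->
    forall (E : {set 'rV[F]_d}),
      let q : R := #|F|%:R in
      let s : R := d%:R - (d%:R - 1) / (k%:R + 1) in
      c * (q `^ s) <= #|E|%:R ->
      C * (2 ^- (k * k)) * #|Delta k [set: 'rV[F]_d]|%:R <= #|Delta k E|%:R.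
Proof.
(* [A] absorbs the power of [c^-1] from the density hypothesis, [B] the power of 2 from the mean
   term; both precede [F], [k] and [E]. *)
have [A A0 Ale] : exists2 A : R,
    0 < A & forall k, (c^-1) ^+ k.+1 <= A * 2 ^+ (k * k).
  by apply: exp_le_exp2_sqr; rewrite invr_ge0 ltW.
have [B B0 Ble] : exists2 A : R, 0 < A & forall k, 2 ^+ k.+1 <= A * 2 ^+ (k * k).
  by apply: exp_le_exp2_sqr.
(* [D] is the constant of [sum_overlap_exp], kept opaque; [H] is that of [sum_fixed_exp]. *)
have [D DE] : exists D : R, D = 4 * (4 * 3 ^+ d) by eexists.
pose H : R := d.+1%:R * d%:R ^+ d.
have D0 : 0 < D by rewrite DE !mulr_gt0 ?exprn_gt0.
have H0 : 0 < H by rewrite mulr_gt0 ?exprn_gt0 ?ltr0n // (leq_trans _ hd).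
exists (H * (B + D * A))^-1; split.
  by rewrite invr_gt0 mulr_gt0 // addr_gt0 // mulr_gt0.
move=> F F2 k dk E q s hE.
have {}F2 : 2 != 0 :> F by move: F2; rewrite inE.
have q_gt0 : 0 < q by rewrite ltr0n; apply/card_gt0P; exists 0.
set e : R := #|E|%:R in hE.
have k0 : (0 < k)%N by rewrite (leq_trans _ dk) // (leq_trans _ hd).
have e_gt0 : 0 < e by apply: lt_le_trans hE; rewrite mulr_gt0 ?powR_gt0.
(* Since [s * (k + 1) = d * k + 1], the power [k.+1] of the hypothesis involves only an integral
   power of [q]. *)
have eP : c ^+ k.+1 * q ^+ (d * k).+1 <= e ^+ k.+1.
  apply: le_trans (_ : (c * q `^ s) ^+ k.+1 <= _); last first.
    by rewrite lerXn2r ?nnegrE ?mulr_ge0 ?powR_ge0 // ltW.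
  rewrite exprMn -[(q `^ s) ^+ _]powR_mulrn ?powR_ge0 // -powRrM.
  suff -> : s * k.+1%:R = (d * k).+1%:R by rewrite powR_mulrn // ltW.
  rewrite /s -(natr1 k) -(natr1 (d * k)) natrM mulrBl divfK ?natr1 ?pnatr_eq0 //.
  by rewrite -natr1; ring.
set N : R := #|orth F d|%:R.
have N_gt0 : 0 < N by rewrite ltr0n; apply/card_gt0P; exists 1%:M; apply: orth1.
have full : #|Delta k [set: 'rV[F]_d]|%:R * N <= H * q ^+ (d * k).
  have := leq_trans (card_Delta_full F d k) (sum_stab F d k).
  move=> /leq_trans/(_ (leq_mul (leqnn _) (sum_fixed_exp F dk))).
  rewrite card_motions -(ler_nat R) !natrM !natrX mulrA [leRHS]mulrC.
  by rewrite ler_pM2r ?exprn_gt0.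
set T : R := #|Delta k [set: 'rV[F]_d]|%:R in full *.
set X : R := #|Delta k E|%:R.
set K := (B + D * A) * 2 ^+ (k * k).
have low : q ^+ (d * k) <= X * N * K.
  have := leq_card_Delta k E; rewrite -(ler_nat R) natrM natrX => /le_trans.
  move=> /(_ _ (ler_wpM2l (ler0n _ _) (sum_overlap_exp R E F2 k0))).
  rewrite -/q -/e -/N -/X (mulrA X N) => le_e.
  (* Times [q ^+ (d * k)], the mean term becomes [(2 * e ^+ 2) ^+ k.+1]; in the variance term [eP]
     trades [q ^+ (d * k).+1] for [e ^+ k.+1]. *)
  have le_K : (q ^+ d * (2 * (e ^+ 2 / q ^+ d)) ^+ k.+1
      + 4 * (4 * 3 ^+ d) * q * e ^+ k.+1) * q ^+ (d * k) <= e ^+ (2 * k.+1) * K.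
    have q_neq0 : q ^+ d != 0 by rewrite expf_neq0 // gt_eqF.
    have -> : e ^+ (2 * k.+1) * K =
        B * 2 ^+ (k * k) * e ^+ (2 * k.+1) + D * A * 2 ^+ (k * k) * e ^+ (2 * k.+1).
      by rewrite /K; ring.
    rewrite mulrDl lerD //.
      rewrite exprM mulrAC -exprS -exprMn.
      have -> : q ^+ d * (2 * (e ^+ 2 / q ^+ d)) = 2 * e ^+ 2 by field.
      by rewrite exprMn -exprM ler_wpM2r // exprn_ge0 // ltW.
    have -> : 4 * (4 * 3 ^+ d) * q * e ^+ k.+1 * q ^+ (d * k) =
        D * (q ^+ (d * k).+1 * e ^+ k.+1) by rewrite DE (exprS q); ring.
    rewrite -!mulrA (ler_pM2l D0) mul2n -addnn exprD !mulrA ler_pM2r ?exprn_gt0 //.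
    apply: (@le_trans _ _ (c^-1 ^+ k.+1 * e ^+ k.+1)).
      by rewrite exprVn ler_pdivlMl ?exprn_gt0.
    by rewrite ler_pM2r ?exprn_gt0 // Ale.
  have e2_gt0 : 0 < e ^+ (2 * k.+1) by rewrite exprn_gt0.
  rewrite -(ler_pM2l e2_gt0).
  apply: (le_trans (ler_wpM2r _ le_e)); first by rewrite exprn_ge0 // ltW.
  rewrite -[X * N * _ * _]mulrA; apply: le_trans (ler_wpM2l _ le_K) _.
    by rewrite mulr_ge0 ?ler0n.
  by rewrite mulrCA.
(* Both bounds carry the same [N], which cancels next. *)
have H1 : T * N <= H * K * X * N.
  have -> : H * K * X * N = H * (X * N * K) by ring.
  by apply: (le_trans full); rewrite ler_pM2l.
rewrite ler_pM2r // in H1.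
have K2 : (0 : R) < 2 ^+ (k * k) by rewrite exprn_gt0.
have BA : 0 < B + D * A by rewrite addr_gt0 // mulr_gt0.
rewrite -invfM (ler_pdivrMl _ _ (mulr_gt0 (mulr_gt0 H0 BA) K2)).
by have -> : H * (B + D * A) * 2 ^+ (k * k) * X = H * K * X by rewrite /K; ring.
Qed.
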